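(* Let $X$ be a topological space that is a union of countably many quasi-components of compact subsets of $X$. Then TWO has a winning strategy in the mildly Menger game $G_{fin}(\mathcal{C}_{\mathcal{O}}, \mathcal{C}_{\mathcal{O}})$ on $X$.
   Context: A set is clopen if it is both open and closed. A subset $F$ of $X$ is called a quasi-component of a compact subset $K$ of $X$ if $F=\bigcap\{U : U \text{ is clopen in } X,\ K\subseteq U\}$. $\mathcal{C}_{\mathcal{O}}$ is the collection of all clopen covers of $X$ (covers by clopen subsets of $X$). The mildly Menger game $G_{fin}(\mathcal{C}_{\mathcal{O}},\mathcal{C}_{\mathcal{O}})$ on $X$ is played by ONE and TWO in innings $n\in\omega$: in inning $n$, ONE chooses $\mathcal{U}_n\in\mathcal{C}_{\mathcal{O}}$, and then TWO chooses a finite subset $\mathcal{V}_n\subseteq\mathcal{U}_n$. TWO wins the play if $\bigcup_{n\in\omega}\mathcal{V}_n\in\mathcal{C}_{\mathcal{O}}$; otherwise ONE wins. A strategy for TWO is a function assigning a legal move to each finite sequence of ONE's moves up to and including the current one; it is winning if TWO wins every play in which it is followed. *)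

(* Defs.v *)
From mathcomp Require Import all_boot all_order all_algebra.
From mathcomp Require Import all_classical all_reals all_analysis.

Set Implicit Arguments.
Unset Strict Implicit.
Unset Printing Implicit Defensive.

Local Open Scope classical_set_scope.

Definition quasi_component_of (X : topologicalType) (K F : set X) : Prop :=
  F = \bigcap_(U in [set U : set X | clopen U /\ K `<=` U]) U.

Definition clopen_covers (X : topologicalType) : set (set (set X)) :=
  [set UU | UU `<=` clopen /\ \bigcup_(U in UU) U = [set: X]].

(* A strategy for TWO in G_fin(A, B) answers a history [:: U_0; ...; U_n] of
   ONE's moves, current one included. Its values on the empty history and on
   histories containing illegal moves of ONE are irrelevant. *)
Definition is_strategy_TWO (T : Type) (A : set (set (set T)))
    (sigma : seq (set (set T)) -> set (set T)) : Prop :=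
  forall (s : seq (set (set T))) (UU : set (set T)),
    [set` rcons s UU] `<=` A ->
    finite_set (sigma (rcons s UU)) /\ sigma (rcons s UU) `<=` UU.

Definition TWO_wins_every_play (T : Type) (A B : set (set (set T)))
    (sigma : seq (set (set T)) -> set (set T)) : Prop :=
  forall UU : nat -> set (set T),
    (forall n, A (UU n)) -> B (\bigcup_n sigma (mkseq UU n.+1)).

Definition TWO_has_winning_strategy_Gfin (T : Type)
    (A B : set (set (set T))) : Prop :=
  exists sigma : seq (set (set T)) -> set (set T),
    is_strategy_TWO A sigma /\ TWO_wins_every_play A B sigma.

(* Main.v *)
(* Finitely many members of a clopen cover that cover a compact set K have a
   clopen union containing K, hence containing the quasi-component of K. So in
   inning n TWO takes care of the n-th quasi-component of an enumeration. *)
Require Import Defs.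
From mathcomp Require Import all_boot all_order all_algebra.
From mathcomp Require Import all_classical all_reals all_analysis.

Local Open Scope classical_set_scope.

(* The library's [compact_cover] requires a pointed space; here near-covering is
   applied along the filter of families that contain some finite part of UU. *)
Lemma compact_finite_subcover (X : topologicalType) (K : set X)
    (UU : set (set X)) :
  compact K -> UU `<=` open -> K `<=` \bigcup_(U in UU) U ->
  exists VV : set (set X),
    [/\ finite_set VV, VV `<=` UU & K `<=` \bigcup_(V in VV) V].
Proof.
move=> /compact_near_coveringP cK openUU covK.
pose Fin : set_system (set (set X)) := [set A | exists VV : set (set X),
  [/\ finite_set VV, VV `<=` UU & forall WW, VV `<=` WW -> A WW]].
have FinF : Filter Fin.
  split.
  - by exists set0; split.
  - move=> A B [VA [finA subA AP]] [VB [finB subB BP]].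
    exists (VA `|` VB); split; first by rewrite finite_setU.
      by rewrite subUset.
    by move=> WW; rewrite subUset => -[/AP ? /BP ?].
  - move=> A B AB [VV [finV subV AP]]; exists VV; split=> // WW /AP; exact: AB.
have [x Kx|VV [finV subV VVP]] :=
  cK _ Fin (fun VV x => (\bigcup_(V in VV) V) x) FinF.
  have [U UUU Ux] := covK x Kx.
  (* Every point of [U] is covered by every family that has [U] as a member, and such families are
     large for [Fin] because [[set U]] is a finite part of [UU]. *)
  exists (U, [set VV | VV U]) => /=; last by move=> [y VV] [/= Uy VVU]; exists U.
  split; first by apply: open_nbhs_nbhs; split=> //; exact: openUU.
  exists [set U]; split=> //; first by move=> _ ->.
  by move=> WW; apply.
by exists VV; split=> //; exact: VVP.
Qed.

Lemma quasi_component_finite_subcover (X : topologicalType) (K F : set X)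
    (UU : set (set X)) :
  compact K -> quasi_component_of K F -> clopen_covers UU ->
  exists VV : set (set X),
    [/\ finite_set VV, VV `<=` UU & F `<=` \bigcup_(V in VV) V].
Proof.
move=> cK -> [clUU covUU].
have [||VV [finVV subVV KVV]] := @compact_finite_subcover X K UU cK.
- by move=> U /clUU[].
- by rewrite covUU.
(* The union of [VV] is one of the clopen sets whose intersection is [F]; finiteness of [VV] makes
   it closed. *)
exists VV; split=> // x; apply; split=> //; split.
- by apply: bigcup_open => V /subVV/clUU[].
- by apply: closed_bigcup => // V /subVV/clUU[].
Qed.

Theorem proposition4p2 (X : topologicalType)
  (hX : exists C : set (set X),
      [/\ countable C,
          (forall F : set X, C F ->
             exists K : set X, compact K /\ quasi_component_of K F)
        & \bigcup_(F in C) F = [set: X]]) :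
  TWO_has_winning_strategy_Gfin (@clopen_covers X) (@clopen_covers X).
Proof.
have [C [/countable_injP[f finj] qcC covC]] := hX.
(* As [f] is injective on [C], at most one quasi-component has number [n]; if none has, the last
   condition is vacuous. *)
pose answer n (UU VV : set (set X)) :=
  [/\ finite_set VV, VV `<=` UU &
      forall F, C F -> f F = n -> F `<=` \bigcup_(V in VV) V].
have answer_ex n UU : clopen_covers UU -> exists VV, answer n UU VV.
  move=> covUU; have [[F [CF fF]]|noF] := pselect (exists F, C F /\ f F = n).
    have [K [cK qF]] := qcC _ CF.
    have [VV [finVV subVV FVV]] :=
      @quasi_component_finite_subcover X K F UU cK qF covUU.
    exists VV; split=> // G CG fG.
    by have -> : G = F by apply: finj; rewrite ?inE// fG.
  by exists set0; split=> // F CF fF; case: noF; exists F.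
(* The history of inning [n] has length [n.+1], hence the predecessor. TWO uses only this number and
   the current cover. After a legal move an answer exists, so neither default [set0] comes into
   play. *)
pose sigma s := xget set0 (answer (size s).-1 (last set0 s)).
have sigmaP s UU : clopen_covers UU -> answer (size s) UU (sigma (rcons s UU)).
  move=> /(answer_ex (size s))[VV hVV].
  rewrite /sigma size_rcons last_rcons.
  exact: xgetPex (ex_intro _ VV hVV).
exists sigma; split.
  move=> s UU sA; have [] // := sigmaP s UU.
  by apply: sA; rewrite /= mem_rcons mem_head.
move=> UU hUU.
have mkP n : answer n (UU n) (sigma (mkseq UU n.+1)).
  (* The inning's number is the length of the history before the current move. *)
  by rewrite mkseqS -{1}(size_mkseq UU n); exact: sigmaP.
split.
  move=> V [n _ Vn]; have [_ sub _] := mkP n.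
  by apply: (hUU n).1; exact: sub.
rewrite -subTset -covC => x [F CF Fx].
have [_ _ /(_ F CF erefl x Fx)[V VV Vx]] := mkP (f F).
by exists V => //; exists (f F).
Qed.
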